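(* Let $d,e\ge 0$ be integers. The discriminant of the lattice $\Lambda_{d,e}$ is \[ \delta(\Lambda_{d,e}) = \prod_{i=0}^d\prod_{j=1}^e \frac{d + i + j + 1}{i + j}. \]
   Context: A lattice in $\mathbb{R}^m$ is a discrete free abelian subgroup. If $\Lambda\subseteq\mathbb{R}^m$ is a lattice of rank $n$ with basis $v_1,\dots,v_n$, its discriminant $\delta(\Lambda)$ is the square of the $n$-dimensional volume of the fundamental domain $\{\sum_{i=1}^n c_iv_i : 0\le c_i\le 1\}$; equivalently $\delta(\Lambda)=\det(MM^T)$, where $M$ is the matrix with rows $v_1,\dots,v_n$ (this is independent of the basis). For integers $d,e\ge 0$, $\Lambda_{d,e}$ is the rank-$(d+1)$ lattice in $\mathbb{R}^{d+e+1}$ spanned by the $d+1$ vectors \[ u_i := \left(\binom{0}{i}, \binom{1}{i},\ldots, \binom{d+e}{i}\right) \in \mathbb{Z}^{d+e+1},\qquad 0\le i\le d, \] where $\binom{j}{i}=0$ if $j<i$. *)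

(* Defs.v *)
From HB Require Import structures.
From mathcomp Require Import all_boot all_order all_algebra.
From mathcomp Require Import all_classical all_reals all_analysis.

Set Implicit Arguments.
Unset Strict Implicit.
Unset Printing Implicit Defensive.

Import Order.TTheory GRing.Theory Num.Theory.
Import numFieldNormedType.Exports.
Local Open Scope classical_set_scope.
Local Open Scope ring_scope.

Definition int_comb (R : realType) (n m : nat) (M : 'M[R]_(n, m))
  (c : 'I_n -> int) : 'rV[R]_m := \sum_(i < n) row i M *~ c i.

Definition int_span (R : realType) (n m : nat) (M : 'M[R]_(n, m)) :
  set 'rV[R]_m := range (int_comb M).

(* The rows of [M] form a basis of the abelian group [L]: linear independence
   is over the integers. *)
Definition is_basis (R : realType) (n m : nat) (L : set 'rV[R]_m)
  (M : 'M[R]_(n, m)) : Prop :=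
  L = int_span M /\ (forall c : 'I_n -> int, int_comb M c = 0 -> forall i, c i = 0).

(* [isolated L = L] says that the subspace topology on [L] is discrete. *)
Record lattice (R : realType) (m : nat) := Lattice {
  lattice_set :> set 'rV[R]_m;
  lattice_zmod : zmod_closed [in lattice_set];
  lattice_discrete : isolated lattice_set = lattice_set;
  lattice_free : exists (n : nat) (M : 'M[R]_(n, m)), is_basis lattice_set M }.

(* The Gram determinant of a basis is the square of the n-dimensional volume of
   the fundamental domain. By [discriminantE] below, the value does not depend on the chosen basis. *)
Definition discriminant (R : realType) (m : nat) (L : lattice R m) : R :=
  get [set delta : R | exists (n : nat) (M : 'M[R]_(n, m)),
         is_basis L M /\ delta = \det (M *m M^T)].

Lemma int_combE (R : realType) (n m : nat) (M : 'M[R]_(n, m)) c :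
  int_comb M c = map_mx intr (\row_i c i) *m M.
Proof.
rewrite mulmx_sum_row; apply: eq_bigr => i _.
by rewrite !mxE scaler_int.
Qed.

Lemma basis_change (R : realType) (n p m : nat) (L : set 'rV[R]_m)
    (M : 'M[R]_(n, m)) (N : 'M[R]_(p, m)) :
  is_basis L M -> is_basis L N -> exists U : 'M[int]_(n, p), M = map_mx intr U *m N.
Proof.
move=> [LM _] [LN _].
have H i : exists c, int_comb N c = row i M.
  have : L (row i M).
    rewrite LM; exists (fun j => (i == j)%:R) => //.
    rewrite /int_comb (bigD1 i) //= eqxx big1 ?addr0 ?mulr1z // => j.
    by rewrite eq_sym => /negbTE ->; rewrite mulr0z.
  by rewrite LN => -[c _ <-]; exists c.
have [f Hf] := choice H.
exists (\matrix_(i, j) f i j); apply/row_matrixP => i.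
rewrite row_mul -Hf int_combE; congr (_ *m _).
by apply/rowP => j; rewrite !mxE.
Qed.

Lemma basis_free (R : realType) (n m : nat) (L : set 'rV[R]_m)
    (M : 'M[R]_(n, m)) (A B : 'M[int]_n) :
  is_basis L M -> map_mx intr A *m M = map_mx intr B *m M -> A = B.
Proof.
move=> [_ fM] /eqP; rewrite -subr_eq0 -mulmxBl -map_mxB => /eqP AB.
apply/matrixP => i j; apply/eqP; rewrite -subr_eq0; apply/eqP.
apply: (fM (fun k => A i k - B i k)) j.
rewrite int_combE; transitivity (row i (0 : 'M[R]_(n, m))); last first.
  by apply/rowP => k; rewrite !mxE.
rewrite -AB row_mul; congr (_ *m _).
by apply/rowP => k; rewrite !mxE.
Qed.

Lemma basis_det (R : realType) (n p m : nat) (L : set 'rV[R]_m)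
    (M : 'M[R]_(n, m)) (N : 'M[R]_(p, m)) :
  is_basis L M -> is_basis L N -> \det (M *m M^T) = \det (N *m N^T).
Proof.
move=> bM bN.
have [U MU] := basis_change bM bN; have [V NV] := basis_change bN bM.
have UV : U *m V = 1%:M.
  by apply: (basis_free bM); rewrite map_mxM map_mx1 mul1mx -mulmxA -NV.
have VU : V *m U = 1%:M.
  by apply: (basis_free bN); rewrite map_mxM map_mx1 mul1mx -mulmxA -MU.
have np : n = p.
  have UVR : map_mx (intr : int -> R) U *m map_mx intr V = 1%:M.
    by rewrite -map_mxM UV map_mx1.
  have VUR : map_mx (intr : int -> R) V *m map_mx intr U = 1%:M.
    by rewrite -map_mxM VU map_mx1.
  apply/eqP; rewrite eqn_leq; apply/andP; split.
    by rewrite -(mxrank1 R n) -UVR (leq_trans (mxrankM_maxr _ _)) ?rank_leq_row.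
  by rewrite -(mxrank1 R p) -VUR (leq_trans (mxrankM_maxr _ _)) ?rank_leq_row.
subst p; rewrite MU trmx_mul mulmxA -(mulmxA _ N) !det_mulmx det_tr.
have : \det U ^+ 2 = 1.
  have /(congr1 determinant) := UV; rewrite det_mulmx det1 => dUV.
  have : \det U \is a GRing.unit by apply/unitrP; exists (\det V); rewrite mulrC.
  by case/orP => /eqP ->.
rewrite !det_map_mx mulrAC -expr2 -rmorphXn /= => ->.
by rewrite mul1r.
Qed.

Lemma discriminantE (R : realType) (n m : nat) (L : lattice R m)
    (M : 'M[R]_(n, m)) :
  is_basis L M -> discriminant L = \det (M *m M^T).
Proof.
move=> bM; rewrite /discriminant.
have : [set delta : R | exists (n : nat) (M : 'M[R]_(n, m)),
         is_basis L M /\ delta = \det (M *m M^T)] (\det (M *m M^T)).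
  by exists n, M.
by move=> /getI [k [N [bN ->]]]; apply: basis_det bN bM.
Qed.

Definition Lambda_mx (R : realType) (d e : nat) : 'M[R]_(d.+1, (d + e).+1) :=
  \matrix_(i, j) 'C(j, i)%:R.

Lemma int_span_zmod (R : realType) (n m : nat) (M : 'M[R]_(n, m)) :
  zmod_closed [in int_span M].
Proof.
split.
  rewrite inE; exists (fun=> 0) => //.
  by rewrite /int_comb big1 // => i _; rewrite mulr0z.
move=> x y; rewrite !inE => -[a _ <-] [b _ <-].
exists (fun i => a i - b i) => //.
by rewrite /int_comb -sumrB; apply: eq_bigr => i _; rewrite mulrzBr.
Qed.

Lemma Lambda_discrete (R : realType) (d e : nat) :
  isolated (int_span (Lambda_mx R d e)) = int_span (Lambda_mx R d e).
Proof.
have intL x : int_span (Lambda_mx R d e) x -> forall j, exists z : int, x 0 j = z%:~R.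
  move=> [c _ <-] j; exists (\sum_(i < d.+1) 'C(j, i)%:R * c i).
  rewrite int_combE mxE rmorph_sum; apply: eq_bigr => i _.
  by rewrite !mxE rmorphM /= mulrC rmorph_nat.
apply/seteqP; split; first exact: isolatedS.
move=> x Lx; split; first by rewrite inE.
exists (ball x (1 : R)); first exact: nbhsx_ballx.
apply/seteqP; split=> [y [xy Ly]|y ->]; last by split=> //; apply: ballxx.
case: xy => _ xy; apply/rowP => j; move: (xy ord0 j).
have [a ->] := intL _ Lx j; have [b ->] := intL _ Ly j.
rewrite /ball /= -rmorphB /= -intr_norm -[X in _ < X]/(1%:~R) ltr_int.
by rewrite -[1]add0r ltzD1 normr_le0 subr_eq0 => /eqP ->.
Qed.

Lemma Lambda_basis (R : realType) (d e : nat) :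
  is_basis (int_span (Lambda_mx R d e)) (Lambda_mx R d e).
Proof.
split=> // c c0.
have H k (kd : (k < d.+1)%N) : c (Ordinal kd) = 0.
  elim/ltn_ind: k kd => k IH kd.
  have kde : (k < (d + e).+1)%N by rewrite (leq_trans kd) // ltnS leq_addr.
  move/(congr1 (fun v : 'rV[R]__ => v 0 (Ordinal kde))): c0.
  rewrite int_combE !mxE (bigD1 (Ordinal kd)) //= big1 => [|[i id] ik].
    by rewrite !mxE binn mulr1 addr0 => /eqP; rewrite intr_eq0 => /eqP.
  rewrite !mxE /=; have [lt_ik|le_ki] := ltnP i k; first by rewrite IH // mul0r.
  rewrite bin_small ?mulr0 // ltn_neqAle le_ki andbT.
  by apply: contraNneq ik => ki; apply/eqP/val_inj.
by move=> [i id]; apply: H.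
Qed.

Definition Lambda (R : realType) (d e : nat) : lattice R (d + e).+1 :=
  Lattice (int_span_zmod (Lambda_mx R d e)) (Lambda_discrete R d e)
    (ex_intro _ _ (ex_intro _ _ (Lambda_basis R d e))).

(* Main.v *)
(* Multiplying the Gram matrix on both sides by unitriangular matrices (up to
   signs) replaces the row basis [C(x, i)] by [C(x + i, i)] on one side and
   [C(d + e - x, j)] on the other; the resulting matrix has entries
   [C(d + e + 1 + i, i + j + 1)], i.e. it is [1 / (i + j + 1)!], which does not
   depend on [e], with rows and columns scaled by factorials. Hence the ratio of
   the discriminants for [e] and for [0] is explicit, and for [e = 0] the matrix
   of the [u_i] is unitriangular, so that the discriminant is [1]. *)
Require Import Defs.
From HB Require Import structures.
From mathcomp Require Import all_boot all_order all_algebra.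
From mathcomp Require Import ring.
From mathcomp Require Import all_classical all_reals all_analysis.
Set Implicit Arguments.
Unset Strict Implicit.
Unset Printing Implicit Defensive.
Import Order.TTheory GRing.Theory Num.Theory.
Local Open Scope ring_scope.

(** Classify the subsets of size [i + j + 1] of [n + i + 1] points by the position [x + i] of their
    element number [i + 1]: [i] elements lie below it and [j] among the [n - x] points above. *)
Lemma sum_bin_addl_subr (n i j : nat) :
  (\sum_(x < n.+1) 'C(x + i, i) * 'C(n - x, j) = 'C((n + i).+1, (i + j).+1))%N.
Proof.
elim: n j => [|n IH] j.
  rewrite big_ord_recl big_ord0 addn0 !add0n subn0 binn mul1n.
  by case: j => [|j]; rewrite ?addn0 ?binn // !bin_small // addnS !ltnS leq_addr.
rewrite big_ord_recr /= subnn.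
case: j => [|j].
  rewrite bin0 muln1 addSn binS -IH addn0; congr addn.
  by apply: eq_bigr => x _; rewrite !bin0.
rewrite bin0n muln0 addn0 addSn binS -IH addnS -IH -big_split /=.
apply: eq_bigr => x _; rewrite -mulnDr; congr muln.
by rewrite subSn ?binS // -ltnS.
Qed.

(** Inclusion-exclusion for the [j]-subsets of an [n]-set that avoid [x] given points. Only [k <= j]
    occurs, so the change of basis it provides is triangular. *)
Lemma bin_subr_expand (R : pzRingType) (n x j : nat) : (x <= n)%N ->
  \sum_(k < j.+1) (-1) ^+ k * 'C(n - k, j - k)%:R * 'C(x, k)%:R
    = 'C(n - x, j)%:R :> R.
Proof.
elim: x n j => [|x IH] n j.
  move=> _; rewrite big_ord_recl big1 => [|k _]; last by rewrite bin0n mulr0.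
  by rewrite !subn0 bin0 mulr1 mul1r addr0.
case: n => // n; rewrite ltnS => xn; rewrite big_ord_recl /= subSS.
case: j => [|j]; first by rewrite big_ord0 !bin0 !mulr1 addr0.
under eq_bigr => k _ do rewrite /bump /= add1n binS natrD mulrDr !subSS.
rewrite big_split /= addrA.
have -> : \sum_(k < j.+1) (-1) ^+ k.+1 * 'C(n - k, j - k)%:R * 'C(x, k)%:R
    = - 'C(n - x, j)%:R :> R.
  rewrite -IH // -sumrN; apply: eq_bigr => k _.
  by rewrite exprS !mulN1r !mulNr.
have := IH n.+1 j.+1 (leqW xn); rewrite big_ord_recl /= !bin0 => ->.
by rewrite subSn // binS natrD addrK.
Qed.

Section GramDeterminant.
Variables (R : numFieldType) (d : nat).

Let M (e : nat) : 'M[R]_(d.+1, (d + e).+1) := \matrix_(i, j) 'C(j, i)%:R.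

Let K : 'M[R]_d.+1 := \matrix_(i, j) ((i + j).+1`!%:R)^-1.

Let s : R := \prod_(j < d.+1) (-1) ^+ j.

Lemma det_gram_bin_scaled (e : nat) :
  \det (M e *m (M e)^T) * s =
  \prod_(i < d.+1) ((d + e + i).+1`!%:R / (d + e - i)`!%:R) * \det K.
Proof.
pose A : 'M[R]_d.+1 := \matrix_(i, k) 'C(i, k)%:R.
(* The guard is needed for triangularity: truncated subtraction would make the binomial equal to 1
   when [k > j]. *)
pose B : 'M[R]_d.+1 := \matrix_(j, k)
  if (k <= j)%N then (-1) ^+ k * 'C(d + e - k, j - k)%:R else 0.
have detA : \det A = 1.
  rewrite det_trig; first by rewrite big1 // => i _; rewrite mxE binn.
  by apply/is_trig_mxP => i j ij; rewrite mxE bin_small.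
have detB : \det B = s.
  rewrite det_trig.
    by apply: eq_bigr => i _; rewrite mxE leqnn subnn bin0 mulr1.
  by apply/is_trig_mxP => i j ij; rewrite mxE leqNgt ij.
(* Vandermonde convolution, with ['C(i, i - k) = 'C(i, k)]; the terms with [i < k <= d] vanish. *)
have AM : A *m M e = \matrix_(i, x) 'C(x + i, i)%:R.
  apply/matrixP => i x; rewrite !mxE -binomial.Vandermonde natr_sum.
  rewrite -(big_mkord xpredT (fun k => ('C(x, k) * 'C(i, i - k))%:R)).
  rewrite (big_nat_widen _ _ d.+1) // big_mkord [RHS]big_mkcond /=.
  apply: eq_bigr => k _; rewrite !mxE -natrM ltnS.
  by case: leqP => ik; [rewrite bin_sub // mulnC | rewrite bin_small].
have BM : B *m M e = \matrix_(j, x) 'C(d + e - x, j)%:R.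
  apply/matrixP => j x; rewrite !mxE -bin_subr_expand -1?ltnS //.
  rewrite -(big_mkord xpredT
    (fun k => (-1) ^+ k * 'C(d + e - k, j - k)%:R * 'C(x, k)%:R)).
  rewrite (big_nat_widen _ _ d.+1) // big_mkord [RHS]big_mkcond /=.
  apply: eq_bigr => k _; rewrite !mxE ltnS.
  by case: leqP => // _; rewrite mul0r.
have H : A *m (M e *m (M e)^T) *m B^T =
    diag_mx (\row_i (d + e + i).+1`!%:R) *m K *m
    diag_mx (\row_j ((d + e - j)`!%:R)^-1).
  rewrite mulmxA -mulmxA -trmx_mul AM BM mul_diag_mx mul_mx_diag.
  apply/matrixP => i j; rewrite !mxE.
  under eq_bigr => x _ do rewrite !mxE -natrM.
  rewrite -natr_sum sum_bin_addl_subr.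
  have jde : (j <= d + e)%N by rewrite (leq_trans _ (leq_addr _ _)) -1?ltnS.
  have le : ((i + j).+1 <= (d + e + i).+1)%N by rewrite ltnS addnC leq_add2r.
  have E : ((d + e + i).+1 - (i + j).+1 = d + e - j)%N.
    by rewrite subSS (addnC i) subnDr.
  by rewrite -[in RHS](bin_fact le) E -mulrA -invfM -natrM (natrM _ 'C(_, _)) mulfK.
have := congr1 determinant H.
rewrite !det_mulmx det_tr detA detB mul1r !det_diag => ->.
by rewrite mulrAC -big_split; congr (_ * _); apply: eq_bigr => i _; rewrite !mxE.
Qed.

Lemma det_gram_bin (e : nat) :
  \det (M e *m (M e)^T) =
  \prod_(i < d.+1) ((d + e + i).+1`!%:R / (d + i).+1`!%:R
                    * (i`!%:R / (i + e)`!%:R)).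
Proof.
have s0 : s != 0 by apply/prodf_neq0 => j _; rewrite signr_eq0.
have fact_neq0 k : k`!%:R != 0 :> R by rewrite pnatr_eq0 -lt0n fact_gt0.
(* For [e = 0] the matrix [M] is square and unitriangular. This lets [\det K] be matched as a common
   factor of both sides without being computed. *)
have K0 : s = \prod_(i < d.+1) ((d + 0 + i).+1`!%:R / (d + 0 - i)`!%:R) * \det K.
  rewrite -det_gram_bin_scaled -[LHS]mul1r; congr (_ * _).
  rewrite /M addn0 det_mulmx det_tr -(det_tr (\matrix_(_, _) _)) det_trig.
    by rewrite big1 ?mulr1 // => i _; rewrite !mxE binn.
  by apply/is_trig_mxP => i j ij; rewrite !mxE bin_small.
apply: (mulIf s0); rewrite det_gram_bin_scaled [in RHS]K0 mulrA; congr (_ * _).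
have rev f : \prod_(i < d.+1) f (d - i)%N = \prod_(i < d.+1) f i :> R.
  rewrite [RHS](reindex_inj rev_ord_inj) /=.
  by apply: eq_bigr => i _; rewrite subSS.
(* Used with [k = e] and [k = 0], to reverse the order of the right-hand scaling factors. *)
have revE k : \prod_(i < d.+1) (d + k - i)`!%:R = \prod_(i < d.+1) (i + k)`!%:R :> R.
  rewrite -(rev (fun i => (i + k)`!%:R)); apply: eq_bigr => i _.
  by rewrite addnC -addnBA -1?ltnS // addnC.
rewrite !big_split /= !prodfV !revE.
under [X in _ = _ * (X / _)]eq_bigr => i _ do rewrite addn0.
under [X in _ = _ * (_ / X)]eq_bigr => i _ do rewrite addn0.
have prod_neq0 f : \prod_(i < d.+1) (f i)`!%:R != 0 :> R by apply/prodf_neq0.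
by field; rewrite !prod_neq0.
Qed.

End GramDeterminant.

Lemma prodr_natr_fact (R : numFieldType) (m e : nat) :
  \prod_(1 <= j < e.+1) (m + j)%:R = (m + e)`!%:R / m`!%:R :> R.
Proof.
have fact_neq0 : m`!%:R != 0 :> R by rewrite pnatr_eq0 -lt0n fact_gt0.
elim: e => [|e IH]; first by rewrite big_geq // addn0 divff.
by rewrite big_nat_recr //= IH addnS factS natrM mulrC mulrA.
Qed.

Theorem theorem2p1 (R : realType) (d e : nat) :
  discriminant (Lambda R d e) =
  \prod_(0 <= i < d.+1) \prod_(1 <= j < e.+1)
    ((d + i + j + 1)%:R / (i + j)%:R).
Proof.
rewrite (@discriminantE _ _ _ (Lambda R d e) _ (Lambda_basis R d e)).
rewrite det_gram_bin big_mkord.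
(* For fixed [i], the denominators are the rising product starting after [m = i], the numerators the
   one starting after [m = d + i + 1]. *)
apply: eq_bigr => i _; rewrite big_split /= prodfV prodr_natr_fact invf_div.
congr (_ * _).
rewrite addnAC -[(d + i + e).+1]addSn -prodr_natr_fact.
by apply: eq_bigr => j _; rewrite addn1 addSn.
Qed.
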